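(* Let $d$ be any positive integer and let $K$ be a $d$-dimensional convex body. Then $\mathrm{coin}(C^d)=2^{d+1}\le\mathrm{coin}(K)$, and thus (affine) $d$-cubes minimize the covering index in all dimensions.
   Context: A $d$-dimensional convex body is a compact convex subset of Euclidean space $\mathbb{E}^d$ with nonempty interior. $C^d$ denotes a $d$-dimensional cube (or any affine image of it). For a $d$-dimensional convex body $K$ and $m\in\mathbb{N}=\{1,2,\dots\}$, $\gamma_m(K)=\inf\{\lambda>0:K\subseteq\bigcup_{i=1}^m(\lambda K+t_i),\ t_i\in\mathbb{E}^d\}$. The covering index of $K$ is $$\mathrm{coin}(K)=\inf\left\{\frac{m}{1-\gamma_m(K)}:\gamma_m(K)\le\tfrac12,\ m\in\mathbb{N}\right\}.$$ *)

(* Defs.v *)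
From HB Require Import structures.
From mathcomp Require Import all_boot all_order all_algebra.
From mathcomp Require Import all_classical all_reals all_analysis.
Set Implicit Arguments.
Unset Strict Implicit.
Unset Printing Implicit Defensive.
Import Order.TTheory GRing.Theory Num.Theory.
Import numFieldNormedType.Exports.
Local Open Scope classical_set_scope.
Local Open Scope ring_scope.

(* Euclidean space E^d is ['rV[R]_d].  The library norm on it is the sup norm,
   but only the topology is used below, and that is the Euclidean one. *)

Definition convex_body (R : realType) (d : nat) (K : set 'rV[R]_d) : Prop :=
  [/\ compact K, convex_set K & interior K !=set0].

Definition homothet (R : realType) (d : nat) (l : R) (t : 'rV[R]_d)
    (K : set 'rV[R]_d) : set 'rV[R]_d :=
  [set l *: x + t | x in K].

(* For m > 0 the set is nonempty (it contains 1) and bounded below, so [inf]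
   is a genuine infimum. *)
Definition gamma (R : realType) (d m : nat) (K : set 'rV[R]_d) : R :=
  inf [set l : R | 0 < l /\
    exists t : 'I_m -> 'rV[R]_d, K `<=` \bigcup_i homothet l (t i) K].

(* The real-valued [inf] returns 0 on the empty set, but a convex body K
   satisfies [gamma m K <= 1 / 2] for some m > 0, by compactness. *)
Definition coin (R : realType) (d : nat) (K : set 'rV[R]_d) : R :=
  inf [set m%:R / (1 - gamma m K) | m in
         [set m : nat | (0 < m)%N /\ gamma m K <= 1 / 2]].

Definition unit_cube (R : realType) (d : nat) : set 'rV[R]_d :=
  [set x | forall i, 0 <= x ord0 i <= 1].

(* Points are row vectors, so matrices act on the right.  Invertibility makes
   the image d-dimensional. *)
Definition affine_cube (R : realType) (d : nat) (C : set 'rV[R]_d) : Prop :=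
  exists (A : 'M[R]_d) (t : 'rV[R]_d),
    A \in unitmx /\ C = [set x *m A + t | x in @unit_cube R d].

Definition minimizes_coin (R : realType) (d : nat) (C : set 'rV[R]_d) : Prop :=
  convex_body C /\ forall L : set 'rV[R]_d, convex_body L -> coin C <= coin L.

(* Main.v *)
Require Import Defs.
From HB Require Import structures.
From mathcomp Require Import all_boot all_order all_algebra.
From mathcomp Require Import all_classical all_reals all_analysis.
From mathcomp Require Import finmap lra ring.
Import Order.TTheory GRing.Theory Num.Theory.
Import numFieldNormedType.Exports.
Local Open Scope classical_set_scope.
Local Open Scope ring_scope.

(** The theorem is a volume estimate followed by one-variable calculus.  If
    [m] translates of [l *: K] cover [K], comparing volumes gives
    [1 <= m * l ^+ d]; passing to the infimum, [1 <= m * g ^+ d] for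
    [g = gamma m K] ([gamma_volume]).  When [g <= 1 / 2], the function
    [g ^+ d * (1 - g)] is increasing up to [1 / 2], hence at most
    [2 ^- d.+1], and so [m / (1 - g) >= 2 ^+ d.+1] ([volume_ratio_bound]).
    For a cube, the [2 ^ d] half-size subcubes attain this bound.

    The volume estimate ([homothet_cover_volume]) needs no measure.  Iterating
    the cover shows that [m ^ k] translates of [l ^+ k *: K] cover [K]
    ([homothet_cover_iter]).  A ball inside [K] contains a cubic grid whose
    mesh exceeds the diameter of [l ^+ k *: K]; each translate then captures
    at most one grid point ([grid_count]), so the grid has at most [m ^ k]
    points.  As the grid has about [(l ^- k) ^+ d] points, up to a factor
    independent of [k], the powers [(m * l ^+ d) ^+ k] stay bounded away from
    zero, which forces [1 <= m * l ^+ d].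

    The covering index is an infimum that would degenerate to [0] on an empty
    index set, so one also needs some [m] with [gamma m K <= 1 / 2]; it comes
    from compactness ([half_cover_exists]). *)

Lemma entry_le_norm {R : realType} {d : nat} (x : 'rV[R]_d) (i : 'I_d) :
  `|x ord0 i| <= `|x|.
Proof.
by rewrite [leRHS]/Num.norm /= mx_normrE; apply: (le_bigmax _ _ (ord0, i)).
Qed.

Lemma norm_row_lt {R : realType} {d : nat} (x : 'rV[R]_d) (e : R) :
  0 < e -> (forall i, `|x ord0 i| < e) -> `|x| < e.
Proof.
move=> e0 xe; rewrite [ltLHS]/Num.norm /= mx_normrE; apply/bigmax_ltP; split => //.
by case=> i j _ /=; rewrite (ord1 i).
Qed.

(** Substituting the cover into itself: each point of [K] has an address, a
    word of length [k] whose letters choose the successive translates. *)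
Lemma homothet_cover_iter {R : realType} {d : nat} {K : set 'rV[R]_d}
    {I : finType} {l : R} {t : I -> 'rV[R]_d} :
  K `<=` \bigcup_i homothet l (t i) K ->
  forall k, exists s : k.-tuple I -> 'rV[R]_d,
    K `<=` \bigcup_w homothet (l ^+ k) (s w) K.
Proof.
move=> Kt; elim=> [|k [s Ks]].
  exists (fun=> 0) => x Kx; exists [tuple] => //; exists x => //.
  by rewrite expr0 scale1r addr0.
exists (fun w : k.+1.-tuple I => l *: s [tuple of behead w] + t (thead w)) => _ /Kt[i _ [y Ky <-]].
have [w _ [z Kz <-]] := Ks _ Ky.
exists [tuple of i :: w] => //; exists z => //.
rewrite theadE; have -> : [tuple of behead [tuple of i :: w]] = w :> k.-tuple I.
  exact: val_inj.
by rewrite scalerDr scalerA -exprS addrA.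
Qed.

(** Two distinct points of a grid of mesh [s] are at sup-distance at least [s],
    so no [B i] contains both: the choice of a piece for each grid point is
    injective. *)
Lemma grid_count {R : realType} {d n : nat} (I : finType) (s : R)
    (c : 'rV[R]_d) (B : I -> set 'rV[R]_d) :
  (forall i x y, B i x -> B i y -> `|x - y| < s) ->
  (forall f : {ffun 'I_d -> 'I_n.+1},
     exists i, B i (c + s *: \row_j (f j)%:R)) ->
  (n.+1 ^ d <= #|I|)%N.
Proof.
move=> Bs /choice[g gB].
have <- : #|{ffun 'I_d -> 'I_n.+1}| = (n.+1 ^ d)%N by rewrite card_ffun !card_ord.
apply: (@leq_card _ _ g) => f f' eg; apply/ffunP => j; apply/eqP/negPn/negP => ne.
have Bf := gB f; rewrite eg in Bf.
have := le_lt_trans (entry_le_norm _ j) (Bs _ _ _ Bf (gB f')).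
rewrite !mxE opprD addrACA subrr add0r -mulrBr normrM.
have s0 : 0 < s by apply: le_lt_trans (Bs _ _ _ Bf Bf).
rewrite gtr0_norm// gtr_pMr// ltNge => /negP; apply.
wlog : f f' ne {eg Bf} / (f j < f' j)%N => [hw|ff'].
  have [|fgt|e] := ltngtP (f j) (f' j); first exact: hw.
    by rewrite distrC; apply: hw => //; rewrite eq_sym.
  by move/eqP: ne; case; apply: val_inj.
by rewrite distrC -natrB ?(ltnW ff')// ger0_norm// ler1n subn_gt0.
Qed.

(** This is the comparison of volumes, obtained by counting grid points at the
    scale [l ^+ k] and letting [k] grow. *)
Lemma homothet_cover_volume {R : realType} {d m : nat} {K : set 'rV[R]_d}
    {l : R} {t : 'I_m -> 'rV[R]_d} : convex_body K -> 0 < l ->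
  K `<=` \bigcup_i homothet l (t i) K -> 1 <= m%:R * l ^+ d.
Proof.
move=> [cK _ [c]]; rewrite /interior /= => /nbhs_ballP[r /= r0 rK] l0 Kt.
have [M M0 KM] : exists2 M, 0 < M & forall x, K x -> `|x| < M.
  have [N [_ NK]] := compact_bounded cK.
  exists (`|N| + 2); first by rewrite ltr_wpDl.
  move=> x Kx; have := NK (`|N| + 1); rewrite (le_lt_trans (ler_norm N)) ?ltrDl//.
  by move=> /(_ isT x Kx)/= /le_lt_trans; apply; rewrite ltrD2l ltr1n.
(* [h] bounds the diameter of a homothet of ratio [l ^+ k]; with [n] the integer
   part of [r / 2 / h], the grid of [n.+1] points per axis stays within
   [r / 2] of [c], while [n.+1 > r / (4 * M) / l ^+ k]. *)
have key k : (r / (4 * M)) ^+ d <= (m%:R * l ^+ d) ^+ k.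
  have [s Ks] := homothet_cover_iter Kt k.
  have lk0 : 0 < l ^+ k by rewrite exprn_gt0.
  pose h := l ^+ k * (2 * M).
  have h0 : 0 < h by rewrite !mulr_gt0.
  pose n := Num.truncn (r / 2 / h).
  have rh0 : 0 <= r / 2 / h by rewrite !divr_ge0// ltW.
  have /andP[nle nlt] := truncn_itv rh0.
  have : (n.+1 ^ d <= #|{: k.-tuple 'I_m}|)%N.
    apply: (@grid_count _ _ _ _ h c (fun w => homothet (l ^+ k) (s w) K)).
      move=> w _ _ [x Kx <-] [y Ky <-].
      rewrite opprD addrACA subrr addr0 -scalerBr normrZ gtr0_norm// /h.
      rewrite ltr_pM2l// (le_lt_trans (ler_normB _ _))// mulr_natl mulr2n.
      by rewrite ltrD ?KM.
    move=> f; suff /Ks[w _ hw] : K (c + h *: \row_j (f j)%:R) by exists w.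
    apply: rK; rewrite -ball_normE /ball_/= opprD addNKr normrN.
    apply: norm_row_lt => // j; rewrite !mxE normrM gtr0_norm// normr_nat.
    rewrite (@le_lt_trans _ _ (r / 2))//; last by rewrite ltr_pdivrMr// ltr_pMr// ltr1n.
    rewrite mulrC -ler_pdivlMr// (le_trans _ nle)// ler_nat.
    by rewrite -ltnS ltn_ord.
  rewrite card_tuple card_ord -(ler_nat R) !natrX => ndm.
  rewrite [leRHS]exprMn -exprM mulnC exprM -ler_pdivrMr ?exprn_gt0// -expr_div_n.
  apply: le_trans ndm; apply: lerXn2r; rewrite ?nnegrE// ?divr_ge0 ?mulr_ge0 ?ltW//.
  apply: le_lt_trans nlt; rewrite le_eqVlt; apply/orP; left; apply/eqP.
  by rewrite /h; field; rewrite ?gt_eqF.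
rewrite leNgt; apply/negP => ml1.
have ml0 : 0 <= m%:R * l ^+ d by rewrite mulr_ge0// exprn_ge0// ltW.
have /cvgr0_norm_lt : (GRing.exp (m%:R * l ^+ d) : R^nat) @ \oo --> 0.
  by apply: cvg_expr; rewrite ger0_norm.
have rd0 : 0 < (r / (4 * M)) ^+ d by rewrite exprn_gt0// divr_gt0// mulr_gt0.
move=> /(_ _ rd0)[N _ /(_ N (leqnn N))/=].
by rewrite ger0_norm ?exprn_ge0// ltNge key.
Qed.

Lemma homothet_ratio1 {R : realType} {d : nat} {K : set 'rV[R]_d} m :
  (0 < m)%N -> exists t : 'I_m -> 'rV[R]_d, K `<=` \bigcup_i homothet 1 (t i) K.
Proof.
case: m => // m _; exists (fun=> 0) => x Kx; exists ord0 => //; exists x => //.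
by rewrite scale1r addr0.
Qed.

(** Taking [d]-th roots turns the volume estimate into a lower bound valid for
    all admissible ratios at once, hence for their infimum. *)
Lemma gamma_volume {R : realType} {d m : nat} {K : set 'rV[R]_d} :
  convex_body K -> (0 < d)%N -> (0 < m)%N ->
  0 < gamma m K /\ 1 <= m%:R * gamma m K ^+ d.
Proof.
move=> hK d0 m0.
pose r : R := (m%:R^-1) `^ (d%:R^-1).
have mV0 : 0 < m%:R^-1 :> R by rewrite invr_gt0 ltr0n.
have r0 : 0 < r by rewrite powR_gt0.
have rd : r ^+ d = m%:R^-1.
  by rewrite -powR_mulrn ?ltW// -powRrM mulVf ?powRr1 ?ltW// pnatr_eq0 -lt0n.
have rg : r <= gamma m K.
  apply: lb_le_inf.
    by exists 1; split => //; apply: homothet_ratio1.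
  move=> l [l0 [t Kt]]; rewrite -(@ler_pXn2r _ d) ?nnegrE ?(ltW l0) ?(ltW r0)// rd.
  by rewrite -div1r ler_pdivrMr ?ltr0n// mulrC; apply: homothet_cover_volume Kt.
have g0 := lt_le_trans r0 rg; split => //.
rewrite mulrC -ler_pdivrMr ?ltr0n// div1r -rd.
by apply: lerXn2r; rewrite ?nnegrE ?(ltW r0) ?(ltW g0).
Qed.

Lemma gamma_le {R : realType} {d : nat} {K : set 'rV[R]_d} {I : finType}
    {l : R} {t : I -> 'rV[R]_d} : 0 < l ->
  K `<=` \bigcup_i homothet l (t i) K -> gamma #|I| K <= l.
Proof.
move=> l0 Kt; apply: ge_inf; first by exists 0 => x [/ltW].
split => //; exists (t \o enum_val) => x /Kt[i _ hi].
by exists (enum_rank i) => //=; rewrite enum_rankK.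
Qed.

(** Since [2 * g <= 1], the product [2 ^+ d.+1 * g ^+ d * (1 - g)] is at most
    its value for exponent one, [4 * (g * (1 - g)) <= 1]. *)
Lemma volume_ratio_bound {R : realType} {d : nat} {a g : R} :
  (0 < d)%N -> 0 <= a -> 0 < g -> g <= 1 / 2 -> 1 <= a * g ^+ d ->
  2 ^+ d.+1 <= a / (1 - g).
Proof.
case: d => // d _ a0 g0 g2 ag; rewrite ler_pdivlMr; last by lra.
have gd : (2 * g) ^+ d <= 1 by rewrite exprn_ile1//; lra.
have gg : 4 * (g * (1 - g)) <= 1 by nra.
apply: (@le_trans _ _ (a * g ^+ d.+1 * (2 ^+ d.+2 * (1 - g)))).
  by rewrite ler_peMl// mulr_ge0 ?exprn_ge0//; lra.
rewrite (_ : _ * _ = a * ((2 * g) ^+ d * (4 * (g * (1 - g))))); last first.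
  by rewrite exprMn !exprS; ring.
by rewrite ler_piMr// mulr_ile1 ?exprn_ge0//; nra.
Qed.

Lemma coin_term_ge {R : realType} {d m : nat} {K : set 'rV[R]_d} :
  convex_body K -> (0 < d)%N -> (0 < m)%N -> gamma m K <= 1 / 2 ->
  2 ^+ d.+1 <= m%:R / (1 - gamma m K).
Proof.
move=> hK d0 m0 gK; have [g0 mg] := gamma_volume hK d0 m0.
exact: volume_ratio_bound.
Qed.

(** If [K] contains the ball of radius [r] at [c], the half-size copy of [K]
    translated by [x - c / 2] contains the ball of radius [r / 2] at [x], and
    finitely many such balls cover [K]. *)
Lemma half_cover_exists {R : realType} {d : nat} {K : set 'rV[R]_d} :
  convex_body K -> exists2 m, (0 < m)%N & gamma m K <= 1 / 2.
Proof.
move=> [cK _ [c ic]].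
have Kc : K c by apply: interior_subset.
move: ic; rewrite /interior /= => /nbhs_ballP[r /= r0 rK].
have r20 : 0 < r / 2 by rewrite divr_gt0.
move: cK; rewrite compact_cover => /(_ _ K (fun x => ball x (r / 2))).
case=> [x _|x Kx|D DK KD].
- exact: ball_open.
- by exists x => //; apply: ballxx.
have [x0 x0D _] := KD _ Kc.
exists #|{: D}|; first by apply/card_gt0P; exists [` x0D]%fset.
apply: (@gamma_le _ _ _ _ _ (fun x : D => val x - (1 / 2) *: c)) => [|y /KD[x xD]].
  lra.
rewrite -ball_normE /ball_/= => xy.
exists [` xD]%fset => //; exists (c + 2 *: (y - x)).
  apply: rK; rewrite -ball_normE /ball_/= opprD addNKr normrN normrZ distrC.
  by rewrite ger0_norm// mulrC -ltr_pdivlMr.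
by apply/rowP => i; rewrite !mxE; field.
Qed.

Lemma coin_ge {R : realType} {d : nat} {K : set 'rV[R]_d} :
  convex_body K -> (0 < d)%N -> 2 ^+ d.+1 <= coin K.
Proof.
move=> hK d0; apply: lb_le_inf.
  by have [m m0 mK] := half_cover_exists hK; exists (m%:R / (1 - gamma m K)), m.
by move=> _ [m [m0 mK] <-]; apply: coin_term_ge.
Qed.

Lemma coin_le {R : realType} {d m : nat} {K : set 'rV[R]_d} :
  (0 < m)%N -> gamma m K <= 1 / 2 -> coin K <= m%:R * 2.
Proof.
move=> m0 mK; apply: (@le_trans _ _ (m%:R / (1 - gamma m K))).
  apply: ge_inf; last by exists m.
  exists 0 => _ [n [_ nK] <-]; rewrite divr_ge0//; lra.
rewrite ler_pdivrMr; last by lra.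
by rewrite -mulrA ler_peMr//; lra.
Qed.

Lemma mulmx_affine_continuous {R : realType} {d : nat} (A : 'M[R]_d)
    (t : 'rV[R]_d) : continuous (fun x : 'rV[R]_d => x *m A + t).
Proof.
have Ac : continuous (mulmxr A : 'rV[R]_d -> 'rV[R]_d).
  apply/bounded_linear_continuous/bounded_funP => r.
  exists (\sum_j r * `|row j A|) => x xr /=.
  rewrite mulmx_sum_row (le_trans (ler_norm_sum _ _ _))//; apply: ler_sum => j _.
  by rewrite normrZ ler_wpM2r// (le_trans (entry_le_norm _ _)).
move=> x; exact: (cvgD (Ac x) (cvg_cst t)).
Qed.

Lemma unit_cube_interior {R : realType} {d : nat} :
  ball (const_mx (1 / 2) : 'rV[R]_d) (1 / 2) `<=` @unit_cube R d.
Proof.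
move=> x; rewrite -ball_normE /ball_/= => hx i.
have := le_lt_trans (entry_le_norm _ i) hx; rewrite !mxE ltr_norml => /andP[]; lra.
Qed.

Lemma affine_cube_convex_body {R : realType} {d : nat} {C : set 'rV[R]_d} :
  affine_cube C -> convex_body C.
Proof.
move=> [A [t [uA ->]]]; split.
- apply: continuous_compact.
    by apply: continuous_subspaceT; exact: mulmx_affine_continuous.
  rewrite (_ : @unit_cube R d = [set x : 'rV[R]_d | forall i, `[0, 1]%classic (x ord0 i)]).
    apply: (@rV_compact _ _ (fun=> `[0 : R, 1]%classic)) => i.
    exact: segment_compact.
  by apply/seteqP; split => x xc i; have := xc i; rewrite /= in_itv.
- move=> _ _ l /set_mem[x xC <-] /set_mem[y yC <-].
  apply/mem_set; exists (l%:num *: x + (1 - l%:num) *: y).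
    move=> i; have := xC i; have := yC i; rewrite !mxE.
    have : 0 <= l%:num by []. have : l%:num <= 1 by [].
    move: (l%:num) => u *; apply/andP; split; nra.
  rewrite mulmxDl -!scalemxAl /conv/= /unstable.onem.
  by rewrite !scalerDr addrACA -scalerDl (addrC _ (1 - _)) subrK scale1r.
- exists (const_mx (1 / 2) *m A + t); rewrite /interior/=.
  have := mulmx_affine_continuous (invmx A) (- t *m invmx A) (const_mx (1 / 2) *m A + t).
  rewrite /continuous_at /= -mulmxDl addrK mulmxK// => /(_ (@unit_cube R d)) cont.
  apply: (@filterS _ _ _ ((fun x => x *m invmx A + - t *m invmx A) @^-1` (@unit_cube R d))).
    move=> x xC; exists (x *m invmx A + - t *m invmx A) => //.
    by rewrite -mulmxDl mulmxKV// subrK.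
  apply: cont; apply/nbhs_ballP; exists (1 / 2) => /=; first lra.
  exact: unit_cube_interior.
Qed.

(** Each coordinate of a point of the unit cube lies in the lower or the upper
    half of the interval; these [d] binary choices index the [2 ^ d] subcubes. *)
Lemma gamma_affine_cube_le {R : realType} {d : nat} {C : set 'rV[R]_d} :
  affine_cube C -> gamma (2 ^ d)%N C <= 1 / 2.
Proof.
move=> [A [t [_ ->]]].
have <- : #|{ffun 'I_d -> bool}| = (2 ^ d)%N by rewrite card_ffun card_bool card_ord.
pose b (f : {ffun 'I_d -> bool}) : 'rV[R]_d := \row_j (f j)%:R.
apply: (@gamma_le _ _ _ _ _ (fun f => (1 / 2) *: (b f *m A) + (1 / 2) *: t)).
  lra.
move=> _ [x xC <-]; pose f := [ffun j => 1 / 2 <= x ord0 j].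
exists f => //; exists ((2 *: x - b f) *m A + t).
  exists (2 *: x - b f) => // j; have := xC j; rewrite !mxE ffunE.
  by case: (lerP (1 / 2) (x ord0 j)) => /= ? /andP[? ?]; apply/andP; split; lra.
rewrite mulmxBl -scalemxAl.
by apply/rowP => j; rewrite ![in LHS]mxE ![in RHS]mxE; field.
Qed.

Theorem theorem5p1 (R : realType) (d : nat) (hd : (0 < d)%N)
    (C : set 'rV[R]_d) (hC : affine_cube C)
    (K : set 'rV[R]_d) (hK : convex_body K) :
  [/\ coin C = 2 ^+ d.+1, 2 ^+ d.+1 <= coin K & minimizes_coin C].
Proof.
have bC := affine_cube_convex_body hC.
have coinC : coin C = 2 ^+ d.+1.
  apply/le_anti/andP; split; last exact: coin_ge.
  have := coin_le _ (gamma_affine_cube_le hC).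
  by rewrite expn_gt0 /= => /(_ isT); rewrite natrX -exprSr.
split => //; first exact: coin_ge.
by split => // L hL; rewrite coinC; exact: coin_ge.
Qed.
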